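(* Let $K,T\subset\mathbb{R}^n$ be two closed bodies such that $u_K=u_T$, i.e. $u_K(\mathcal{E})=u_T(\mathcal{E})$ for every ellipsoid $\mathcal{E}\subset\mathbb{R}^n$. Then $K=T$.
   Context: A closed body in $\mathbb{R}^n$ is a compact convex set $K$ with $K=-K$ and non-empty interior; $\|x\|_K=\inf\{\lambda>0: x\in\lambda K\}$ is the norm with unit ball $K$. An ellipsoid means a centrally-symmetric (centered at the origin), non-degenerate ellipsoid. For an ellipsoid $\mathcal{E}$, $\langle\cdot,\cdot\rangle_{\mathcal{E}}$ is the unique scalar product on $\mathbb{R}^n$ with $\mathcal{E}=\{x:\langle x,x\rangle_{\mathcal{E}}\le 1\}$, and $\mu_{\mathcal{E}}$ is the unique Borel probability measure on $\partial\mathcal{E}$ invariant under all linear isometries of $(\mathbb{R}^n,\langle\cdot,\cdot\rangle_{\mathcal{E}})$. For a body $K$, $M_{\mathcal{E}}(K)=\left(\int_{\partial\mathcal{E}}\|x\|_K^2\,d\mu_{\mathcal{E}}(x)\right)^{1/2}$. For a body $K$ and an ellipsoid $\mathcal{E}$, $u_K(\mathcal{E})$ denotes the unique ellipsoid contained in $K$ at which the infimum $J_K(\mathcal{E})=\inf\{M_{\mathcal{E}}(\mathcal{F}):\mathcal{F}\subset K\text{ an ellipsoid}\}$ is attained (such an ellipsoid exists and is unique). *)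

(* Defs.v *)
From HB Require Import structures.
From mathcomp Require Import all_boot all_order all_algebra.
From mathcomp Require Import all_classical all_reals all_analysis.

Set Implicit Arguments.
Unset Strict Implicit.
Unset Printing Implicit Defensive.

Import Order.TTheory GRing.Theory Num.Theory.
Import numFieldNormedType.Exports.

Local Open Scope classical_set_scope.
Local Open Scope ring_scope.

(* R^n is 'rV[R]_n with its usual topology. *)

Definition closed_body (R : realType) (n : nat) (K : set 'rV[R]_n) : Prop :=
  [/\ compact K, convex_set K, [set - x | x in K] = K & K° !=set0].

Definition body_norm (R : realType) (n : nat) (K : set 'rV[R]_n)
    (x : 'rV[R]_n) : R :=
  inf [set l : R | 0 < l /\ [set l *: y | y in K] x].

Definition scalar_product (R : realType) (n : nat) : Type :=
  {dot 'rV[R]_n for idfun}.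

Definition unit_ball (R : realType) (n : nat) (phi : scalar_product R n) :
    set 'rV[R]_n :=
  [set x | phi x x <= 1].

Definition ellipsoid (R : realType) (n : nat) (E : set 'rV[R]_n) : Prop :=
  exists phi : scalar_product R n, E = unit_ball phi.

Definition boundary (T : topologicalType) (A : set T) : set T :=
  closure A `\` A°.

Definition borelType (R : realType) (n : nat) : measurableType _ :=
  g_sigma_algebraType (@open 'rV[R]_n).

(* A Borel probability measure on the boundary of E is seen as a Borel
   probability measure on R^n that gives mass 1 to the boundary of E. *)
Definition invariant_probability (R : realType) (n : nat) (E : set 'rV[R]_n)
    (mu : probability (borelType R n) R) : Prop :=
  mu (boundary E) = 1%E /\
  exists2 phi : scalar_product R n, E = unit_ball phi &
    forall g : {linear 'rV[R]_n -> 'rV[R]_n},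
      (forall x y, phi (g x) (g y) = phi x y) ->
      forall A : set (borelType R n), measurable A ->
        mu (g @^-1` A) = mu A.

(* If E is an ellipsoid and 0 < n, there is exactly one invariant probability;
   the Dirac mass is a dummy value for the other cases. *)
Definition inv_measure (R : realType) (n : nat) (E : set 'rV[R]_n) :
    probability (borelType R n) R :=
  xget (\d_((0 : 'rV[R]_n) : borelType R n) : probability (borelType R n) R)
       [set mu | invariant_probability E mu].

Definition Mfun (R : realType) (n : nat) (E K : set 'rV[R]_n) : R :=
  Num.sqrt (\int[inv_measure E]_(x in boundary E) (body_norm K x ^+ 2)).

Definition Jfun (R : realType) (n : nat) (K E : set 'rV[R]_n) : R :=
  inf [set Mfun E F | F in [set F | ellipsoid F /\ F `<=` K]].

(* The graph of u_K: [is_u K E F] means F = u_K(E).  For a closed body K and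
   an ellipsoid E, there is exactly one such F. *)
Definition is_u (R : realType) (n : nat) (K E F : set 'rV[R]_n) : Prop :=
  [/\ ellipsoid F, F `<=` K & Mfun E F = Jfun K E].

(* Main.v *)
(* For an ellipsoid E with orthonormal basis e_1, ..., e_n, invariance of mu_E
   under signed permutations of the e_i gives
   M_E(F)^2 = (1/n) * sum_i <e_i, e_i>_F, so u_K(E) minimizes this trace among the
   ellipsoids F contained in K.  Let x be in K and 0 < s < 1.  There is an ellipsoid
   F0 in K with |s x|_F0 < 1.  Take E with e_1 = s x and all other e_i so small that
   the trace of F0 is less than 1: then u_K(E) = u_T(E), whose trace is smaller still,
   contains s x, and it lies in T.  Hence s x is in T, and letting s tend to 1, x is
   in T.

   The existence of an invariant probability is never used: without one, M_E vanishes
   identically, which is the formula above with 0 in place of 1/n. *)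
Require Import Defs.
From HB Require Import structures.
From mathcomp Require Import all_boot all_order all_algebra perm fingroup.
From mathcomp Require Import all_classical all_reals all_analysis.
From mathcomp Require Import measurable_realfun ring lra.

Set Implicit Arguments.
Unset Strict Implicit.
Unset Printing Implicit Defensive.

Import Order.TTheory GRing.Theory Num.Theory.
Import numFieldNormedType.Exports.

Local Open Scope classical_set_scope.
Local Open Scope ring_scope.

(** * Scalar products: bilinearity, coordinates in a basis, construction from a positive definite
    matrix *)

Section dot.
Context {R : realType} {n : nat}.
Implicit Types (phi psi : scalar_product R n) (x y : 'rV[R]_n) (P S : 'M[R]_n).

Lemma dotC phi x y : phi x y = phi y x.
Proof. by rewrite hermitian_subproof expr0 mul1r. Qed.

Lemma dotDl phi x y z : phi (x + y) z = phi x z + phi y z.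
Proof. exact: linearDl. Qed.

Lemma dotZl phi a x y : phi (a *: x) y = a * phi x y.
Proof. exact: linearZl_LR. Qed.

Lemma dotDr phi x y z : phi z (x + y) = phi z x + phi z y.
Proof. by rewrite !(dotC phi z) dotDl. Qed.

Lemma dotZr phi a x y : phi x (a *: y) = a * phi x y.
Proof. by rewrite !(dotC phi x) dotZl. Qed.

Lemma dot0l phi x : phi 0 x = 0.
Proof. by rewrite -(scale0r 0) dotZl mul0r. Qed.

Lemma dotZZ phi a x : phi (a *: x) (a *: x) = a ^+ 2 * phi x x.
Proof. by rewrite dotZl dotZr mulrA. Qed.

Lemma dot_gt0 phi x : x != 0 -> 0 < phi x x.
Proof. exact: neq0_dnorm_gt0. Qed.

Lemma dot_ge0 phi x : 0 <= phi x x.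
Proof. by have [->|/dot_gt0/ltW//] := eqVneq x 0; rewrite dot0l. Qed.

Lemma dot_suml phi I (r : seq I) (F : I -> 'rV[R]_n) y :
  phi (\sum_(i <- r) F i) y = \sum_(i <- r) phi (F i) y.
Proof. by apply: (big_morph (phi^~ y)) => [u v|]; rewrite ?dotDl ?dot0l. Qed.

Lemma dot_sumr phi I (r : seq I) (F : I -> 'rV[R]_n) y :
  phi y (\sum_(i <- r) F i) = \sum_(i <- r) phi y (F i).
Proof. by rewrite dotC dot_suml; apply: eq_bigr => i _; rewrite dotC. Qed.

Lemma dot_basis phi P x y : P \in unitmx ->
  phi x y = \sum_i \sum_j (x *m invmx P) 0 i * (y *m invmx P) 0 j *
                          phi (row i P) (row j P).
Proof.
move=> uP; rewrite -{1}(mulmxKV uP x) -{1}(mulmxKV uP y).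
rewrite !(mulmx_sum_row _ P) dot_suml; apply: eq_bigr => i _.
by rewrite dot_sumr; apply: eq_bigr => j _; rewrite dotZl dotZr mulrA.
Qed.

Lemma dot_polarization phi psi :
  (forall x, phi x x = psi x x) -> forall x y, phi x y = psi x y.
Proof.
move=> h x y; have := h (x + y).
rewrite !dotDl !dotDr !h (dotC phi y) (dotC psi y); lra.
Qed.

Lemma dot_of_matrix S : S^T = S ->
  (forall x, x != 0 -> 0 < (x *m S *m x^T) 0 0) ->
  exists phi, forall x y, phi x y = (x *m S *m y^T) 0 0.
Proof.
move=> symS posS; pose f x y : R := (x *m S *m y^T) 0 0.
have fC x y : f x y = (-1) ^+ false * idfun (f y x).
  rewrite expr0 mul1r /f /= -[in RHS]trace_mx11.
  by rewrite -[in RHS]mxtrace_tr !trmx_mul trmxK symS mulmxA trace_mx11.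
have fl z : linear_for *%R (f^~ z).
  by move=> a x y; rewrite /f !mulmxDl -!scalemxAl !mxE.
have fr z : linear_for (idfun \; *%R) (f z).
  by move=> a x y; rewrite /f linearD linearZ mulmxDr -scalemxAr !mxE.
pose mb := @bilinear_isBilinear.Build _ _ _ _ *%R (idfun \; *%R) f (fl, fr).
pose mh := @isHermitianSesquilinear.Build _ _ false idfun f fC.
pose md := @isDotProduct.Build _ _ f posS.
pose g : {dot 'rV[R]_n for idfun} := HB.pack f mb mh md.
by exists g.
Qed.

End dot.

(** * Unit balls of scalar products: their gauge and their boundary *)

Section ball.
Context {R : realType} {n : nat}.
Implicit Types (phi psi : scalar_product R n) (x y : 'rV[R]_n) (P S : 'M[R]_n).

Lemma sum_continuous (T : topologicalType) (I : Type) (r : seq I)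
    (F : I -> T -> R) :
  (forall i, continuous (F i)) -> continuous (fun t => \sum_(i <- r) F i t).
Proof.
move=> cF; elim: r => [|i r IH] t.
  under eq_fun do rewrite big_nil; exact: cvg_cst.
under eq_fun do rewrite big_cons.
by apply: cvgD; [exact: cF|exact: IH].
Qed.

Lemma mul_continuous (T : topologicalType) (f g : T -> R) :
  continuous f -> continuous g -> continuous (fun t => f t * g t).
Proof. by move=> cf cg t; apply: cvgM; [exact: cf|exact: cg]. Qed.

Lemma mulmx_coord_continuous S j : continuous (fun x => (x *m S) 0 j).
Proof.
under eq_fun do rewrite mxE.
apply: sum_continuous => i; apply: mul_continuous; first exact: coord_continuous.
exact: cst_continuous.
Qed.

Lemma dot_continuous phi : continuous (fun x => phi x x).
Proof.
under eq_fun do rewrite (dot_basis phi _ _ (unitmx1 _ _)).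
do 2![apply: sum_continuous => ?].
apply: mul_continuous; last exact: cst_continuous.
by apply: mul_continuous; exact: mulmx_coord_continuous.
Qed.

(** With [s] the square root of [phi x x], the admissible dilation factors are bounded below by [s]
    and include every [l > s], so their infimum is [s]. *)
Lemma sqr_body_norm phi x : body_norm (unit_ball phi) x ^+ 2 = phi x x.
Proof.
set s := Num.sqrt (phi x x).
have s2 : s ^+ 2 = phi x x by rewrite sqr_sqrtr ?dot_ge0.
have s0 : 0 <= s by exact: sqrtr_ge0.
rewrite -s2; congr (_ ^+ 2); rewrite /body_norm.
have lbs l : 0 < l /\ [set l *: y | y in unit_ball phi] x -> s <= l.
  move=> [l0 [y /= y1 xy]]; rewrite -(ler_pXn2r (n := 2)) ?nnegrE ?(ltW l0)//.
  by rewrite s2 -xy dotZZ ler_piMr// sqr_ge0.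
(* The inequality is strict because [s] itself is not admissible when [x = 0]: factors must be
   positive. *)
have mem l : s < l -> 0 < l /\ [set l *: y | y in unit_ball phi] x.
  move=> sl; have l0 := le_lt_trans s0 sl; split => //.
  exists (l^-1 *: x); last by rewrite scalerA divff ?scale1r// gt_eqF.
  rewrite /unit_ball /= dotZZ exprVn mulrC ler_pdivrMr ?exprn_gt0// mul1r -s2.
  by rewrite ler_pXn2r ?nnegrE ?(ltW l0)// ltW.
apply/eqP; rewrite eq_le; apply/andP; split.
  apply/ler_addgt0Pr => e e0; apply: ge_inf; first by exists s.
  by apply: mem; rewrite ltrDl.
by apply: lb_le_inf => //; exists (s + 1); apply: mem; rewrite ltrDl.
Qed.

(** The gauge of the ball recovers the quadratic form, and polarization recovers the scalar
    product. *)
Lemma unit_ball_inj phi psi : unit_ball phi = unit_ball psi ->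
  forall x y, phi x y = psi x y.
Proof.
by move=> h; apply: dot_polarization => x; rewrite -!sqr_body_norm h.
Qed.

Lemma scale_cvg1 x : (fun t : R => t *: x) t @[t --> (1 : R)] --> x.
Proof.
have := @scalel_continuous R 'rV[R]_n x 1; rewrite /continuous_at scale1r; exact.
Qed.

Lemma nbhs_scale_gt1 (A : set 'rV[R]_n) x : nbhs x A ->
  exists2 t : R, 1 < t & A (t *: x).
Proof.
move=> /(scale_cvg1 (x := x)) /nbhs_ballP[e /= e0 he].
exists (1 + e / 2); first by rewrite ltrDl divr_gt0.
apply: he; rewrite /ball /= opprD addNKr normrN gtr0_norm ?divr_gt0//; lra.
Qed.

Lemma nbhs_scale_lt1 (A : set 'rV[R]_n) x : nbhs x A ->
  exists2 t : R, 0 < t < 1 & A (t *: x).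
Proof.
move=> /(scale_cvg1 (x := x)) /nbhs_ballP[e /= e0 he].
pose d := Num.min (e / 2) (1 / 2).
have d0 : 0 < d by rewrite lt_min !divr_gt0.
have [d1 d2] : d <= e / 2 /\ d <= 1 / 2.
  by split; rewrite ge_min lexx ?orbT.
exists (1 - d); first by apply/andP; split; lra.
by apply: he; rewrite /ball /= opprB addrC subrK gtr0_norm//; lra.
Qed.

(** The ball is closed, the points of level below 1 form an open set inside it, and a point of level
    1 leaves the ball under any dilation by [t > 1], so it is not interior. *)
Lemma boundary_unit_ball phi : boundary (unit_ball phi) = [set x | phi x x = 1].
Proof.
have cl : closed (unit_ball phi).
  apply: (@closed_comp _ _ (fun x => phi x x) [set r | r <= 1]); last exact: closed_le.
  by move=> x _; exact: dot_continuous.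
have op : open [set x | phi x x < 1].
  apply: (@open_comp _ _ (fun x => phi x x) [set r | r < 1]); last exact: open_lt.
  by move=> x _; exact: dot_continuous.
rewrite /boundary -(closure_id _).1//; apply/seteqP; split => x /=.
  move=> [x1 Nx]; apply/eqP; rewrite eq_le x1 /= leNgt; apply/negP => xlt.
  apply: Nx; rewrite /interior nbhsE; exists [set x | phi x x < 1] => //.
  by move=> y /= /ltW.
move=> x1; split; first by rewrite /unit_ball /= x1.
move=> /nbhs_scale_gt1[t t1]; rewrite /unit_ball /= dotZZ x1 mulr1 leNgt.
by rewrite exprn_egt1.
Qed.

End ball.

(** * Borel measurability and integration over the unit sphere *)

Section measure.
Context {R : realType} {n : nat}.
Implicit Types (phi psi : scalar_product R n) (x y : 'rV[R]_n) (P S : 'M[R]_n).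
Local Notation borel := (borelType R n).

Lemma open_borel (A : set 'rV[R]_n) : open A -> measurable (A : set borel).
Proof. by move=> oA; apply: sub_sigma_algebra. Qed.

Lemma continuous_borel_fun (f : 'rV[R]_n -> R) : continuous f ->
  measurable_fun setT (f : borel -> R).
Proof.
move=> /continuousP cf; apply: (measurability _ (RGenOpens.measurableE R)).
move=> _ [_ [a [b ->] <-]]; rewrite setTI; apply: open_borel.
exact/cf/interval_open.
Qed.

Lemma continuous_borel_map (g : 'rV[R]_n -> 'rV[R]_n) : continuous g ->
  measurable_fun setT (g : borel -> borel).
Proof.
move=> /continuousP cg.
apply: (@measurability _ _ borel borel setT _ (@open 'rV[R]_n)) => //.
by move=> _ [A oA <-]; rewrite setTI; apply: open_borel; exact: cg.
Qed.

Lemma mulmx_continuous S : continuous (fun x => x *m S).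
Proof.
move=> x A /nbhs_ballP[e /= e0 he].
have h j : \forall y \near x, ball ((x *m S) 0 j) e ((y *m S) 0 j).
  have := @mulmx_coord_continuous _ _ S j x; apply; exact: nbhsx_ballx.
apply: filterS (filter_forall (nbhs_filter x) h) => y hy.
by apply: he; split => // i j; rewrite ord1; exact: hy.
Qed.

Lemma Rintegral_sum d (X : measurableType d) (mu : {measure set X -> \bar R})
    (D : set X) (I : Type) (r : seq I) (f : I -> X -> R) : measurable D ->
  (forall i, mu.-integrable D (EFin \o f i)) ->
  \int[mu]_(x in D) (\sum_(i <- r) f i x) = \sum_(i <- r) \int[mu]_(x in D) f i x.
Proof.
move=> mD intf; elim: r => [|i r IH].
  under eq_Rintegral do rewrite big_nil.
  by rewrite big_nil Rintegral_cst ?mul0r.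
under eq_Rintegral do rewrite big_cons.
rewrite big_cons -IH RintegralD//.
have := integrable_sum mD r (P := xpredT) (fun i _ => intf i).
by congr (integrable mu D _); apply/funext => x /=; exact: sumEFin.
Qed.

Definition unit_sphere phi : set borel := [set x | phi x x = 1].

Lemma measurable_unit_sphere phi : measurable (unit_sphere phi).
Proof.
have := continuous_borel_fun (@dot_continuous _ _ phi) measurableT (measurable_set1 1).
by rewrite setTI.
Qed.

Section invariant.
Variables (phi : scalar_product R n) (mu : probability borel R).
Hypothesis inv_mu : invariant_probability (unit_ball phi) mu.
Local Notation D := (unit_sphere phi).

Lemma mass_unit_sphere : mu D = 1%E.
Proof. by case: inv_mu => + _; rewrite boundary_unit_ball. Qed.

Lemma integrable_sphere (f : 'rV[R]_n -> R) (M : R) : continuous f ->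
  (forall x, phi x x = 1 -> `|f x| <= M) ->
  mu.-integrable D (EFin \o f).
Proof.
move=> cf fM; apply: measurable_bounded_integrable => //.
- exact: measurable_unit_sphere.
- exact: (le_lt_trans (probability_le1 mu (measurable_unit_sphere phi)) (ltry _)).
- by apply: measurable_funTS; exact: continuous_borel_fun.
- exists M; split; first exact: num_real.
  by move=> r Mr x Dx; exact: le_trans (fM _ Dx) (ltW Mr).
Qed.

(** Change of variables: the pushforward of [mu] by [g] agrees with [mu] on Borel sets, and [g]
    preserves the sphere. *)
Lemma Rintegral_isometry (g : {linear 'rV[R]_n -> 'rV[R]_n})
    (f : 'rV[R]_n -> R) : continuous g -> continuous f ->
  (forall x y, phi (g x) (g y) = phi x y) ->
  mu.-integrable D (EFin \o f \o g) ->
  \int[mu]_(x in D) f (g x) = \int[mu]_(x in D) f x.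
Proof.
move=> cg cf isog intfg.
(* Invariance is given for some scalar product [phi'] with the same unit ball; it has the same
   values as [phi], hence the same isometries. *)
case: inv_mu => _ [phi' /unit_ball_inj phiE invg].
have mg := continuous_borel_map cg.
have gD : g @^-1` D = D.
  by apply/seteqP; split => x; rewrite /unit_sphere /= isog.
rewrite /Rintegral; congr fine.
transitivity (\int[pushforward mu (g : borel -> borel)]_(x in D) (f x)%:E)%E.
  rewrite integral_pushforward ?gD//; last exact: measurable_unit_sphere.
  by apply/measurable_EFinP; exact: continuous_borel_fun.
apply: eq_measure_integral => A mA _; rewrite /pushforward/=; apply: invg => //.
by move=> x y; rewrite -!phiE.
Qed.

End invariant.
End measure.

(** * Second moments of the invariant measure and the trace formula for [Mfun] *)

Section moments.
Context {R : realType} {n : nat}.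
Implicit Types (phi psi : scalar_product R n) (x y : 'rV[R]_n) (S : 'M[R]_n).
Local Notation borel := (borelType R n).

(** The basis vectors are the rows of [P], so the coordinates of [x] are the entries of
    [x *m invmx P]. *)
Definition orthonormal_basis phi (P : 'M[R]_n) : Prop :=
  P \in unitmx /\ forall i j, phi (row i P) (row j P) = (i == j)%:R.

Lemma orthonormal_dot phi P x y : orthonormal_basis phi P ->
  phi x y = (x *m invmx P *m (y *m invmx P)^T) 0 0.
Proof.
case=> uP oP; rewrite (dot_basis _ _ _ uP) [RHS]mxE; apply: eq_bigr => i _.
rewrite (bigD1 i)//= oP eqxx mulr1 big1 ?addr0 => [|j ji].
  by congr (_ * _); rewrite [RHS]mxE.
by rewrite oP eq_sym (negbTE ji) mulr0.
Qed.

Section orthonormal.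
Variables (phi : scalar_product R n) (P : 'M[R]_n).
Hypothesis oP : orthonormal_basis phi P.
Local Notation c i x := ((x *m invmx P) 0 i).

Lemma orthonormal_dot_sum x : phi x x = \sum_i c i x ^+ 2.
Proof.
rewrite (orthonormal_dot _ _ oP) mxE; apply: eq_bigr => i _.
by rewrite expr2; congr (_ * _); rewrite mxE.
Qed.

Lemma orthonormal_coord_le1 x i : phi x x <= 1 -> `|c i x| <= 1.
Proof.
rewrite orthonormal_dot_sum (bigD1 i)//= => h.
rewrite -(ler_pXn2r (n := 2)) ?nnegrE// expr1n real_normK ?num_real//.
by apply: le_trans h; rewrite lerDl sumr_ge0// => j _; exact: sqr_ge0.
Qed.

Variable mu : probability borel R.
Hypothesis inv_mu : invariant_probability (unit_ball phi) mu.
Local Notation D := (unit_sphere phi).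

Local Notation m i j := (\int[mu]_(x in D) (c i x * c j x)).

Lemma coord_mul_integrable i j :
  mu.-integrable D (EFin \o (fun x => c i x * c j x)).
Proof.
apply: (@integrable_sphere _ _ phi mu (fun x => c i x * c j x) 1).
  by apply: mul_continuous; exact: mulmx_coord_continuous.
by move=> x x1; rewrite normrM mulr_ile1// orthonormal_coord_le1// x1.
Qed.

(** An orthogonal matrix [A] acting on the coordinates is a linear isometry of [phi], under which
    [mu] is invariant. *)
Lemma orthonormal_moment_isometry (A : 'M[R]_n) i j : A *m A^T = 1%:M ->
  \int[mu]_(x in D) ((x *m invmx P *m A) 0 i * (x *m invmx P *m A) 0 j) = m i j.
Proof.
move=> AA; have [uP _] := oP.
pose g : {linear 'rV[R]_n -> 'rV[R]_n} := mulmxr (invmx P *m A *m P).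
have cE x : g x *m invmx P = x *m invmx P *m A.
  by rewrite /g /= !mulmxA mulmxK.
have isog x y : phi (g x) (g y) = phi x y.
  rewrite !(orthonormal_dot _ _ oP) !cE trmx_mul mulmxA.
  by rewrite -(mulmxA _ A) AA mulmx1.
have gc : continuous g by exact: mulmx_continuous.
have cc : continuous (fun x => c i x * c j x).
  by apply: mul_continuous; exact: mulmx_coord_continuous.
rewrite -(Rintegral_isometry inv_mu gc cc isog).
  by apply: eq_Rintegral => x _; rewrite !cE.
apply: (@integrable_sphere _ _ phi mu ((fun x => c i x * c j x) \o g) 1).
  by move=> x; apply: continuous_comp; [exact: gc|exact: cc].
by move=> x x1; rewrite /= normrM mulr_ile1// orthonormal_coord_le1// isog x1.
Qed.

(** The reflection changing the sign of the [i]-th coordinate turns this moment into its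
    opposite. *)
Lemma moment_offdiag i j : i != j -> m i j = 0.
Proof.
move=> ij; pose d : 'rV[R]_n := \row_k (if k == i then -1 else 1).
have dd : diag_mx d *m (diag_mx d)^T = 1%:M.
  rewrite tr_diag_mx mulmx_diag; apply/matrixP => k l; rewrite !mxE.
  by case: ifP => _; rewrite ?mulrNN ?mulr1.
have dE (v : 'rV[R]_n) k : (v *m diag_mx d) 0 k = (if k == i then -1 else 1) * v 0 k.
  by rewrite mul_mx_diag !mxE mulrC.
have := orthonormal_moment_isometry i j dd.
under eq_Rintegral do rewrite !dE eqxx eq_sym (negbTE ij) mul1r -mulrA.
rewrite RintegralZl; [|exact: measurable_unit_sphere|exact: coord_mul_integrable].
lra.
Qed.

(** Exchanging the coordinates [i] and [j] is an isometry. *)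
Lemma moment_diag_eq i j : m i i = m j j.
Proof.
have pp : perm_mx (tperm i j) *m (perm_mx (tperm i j))^T = 1%:M :> 'M[R]_n.
  by rewrite tr_perm_mx -perm_mxM mulgV perm_mx1.
have pE (v : 'rV[R]_n) : (v *m perm_mx (tperm i j)) 0 j = v 0 i.
  by rewrite -[tperm i j]invgK -col_permE mxE tpermV tpermR.
rewrite -(orthonormal_moment_isometry j j pp).
by apply: eq_Rintegral => x _; rewrite pE.
Qed.

(** The [n] diagonal moments are equal, and their sum is the integral of [phi x x = 1] over a sphere
    of mass 1. *)
Lemma moment_diag i : m i i = n%:R^-1.
Proof.
have n0 : n%:R != 0 :> R by rewrite pnatr_eq0 -lt0n (leq_ltn_trans _ (ltn_ord i)).
apply: (mulfI n0); rewrite divff//.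
transitivity (\sum_j m j j).
  under eq_bigr do rewrite (moment_diag_eq _ i).
  by rewrite sumr_const card_ord mulr_natl.
rewrite -(Rintegral_sum _ (measurable_unit_sphere phi) (f := fun j (x : borel) => c j x * c j x));
  last first.
  by move=> j; exact: coord_mul_integrable.
transitivity (\int[mu]_(x in D) 1).
  apply: eq_Rintegral => x /set_mem; rewrite /unit_sphere /= orthonormal_dot_sum => <-.
  by apply: eq_bigr => j _; rewrite expr2.
rewrite Rintegral_cst; last exact: measurable_unit_sphere.
by rewrite mul1r; exact: (congr1 fine (mass_unit_sphere inv_mu)).
Qed.

Lemma Rintegral_dot psi :
  \int[mu]_(x in D) psi x x = n%:R^-1 * \sum_i psi (row i P) (row i P).
Proof.
have [uP _] := oP.
have int_ij i j a : mu.-integrable D (EFin \o (fun x => a * (c i x * c j x))).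
  have := integrableZl (measurable_unit_sphere phi) a (coord_mul_integrable i j).
  exact.
transitivity (\sum_i \int[mu]_(x in D)
    (\sum_j psi (row i P) (row j P) * (c i x * c j x))).
  rewrite -Rintegral_sum; last 2 first.
  - exact: measurable_unit_sphere.
  - move=> i; have := integrable_sum (measurable_unit_sphere phi) (index_enum 'I_n)
      (P := xpredT) (fun j _ => int_ij i j (psi (row i P) (row j P))).
    by congr (integrable mu D _); apply/funext => x /=; exact: sumEFin.
  apply: eq_Rintegral => x _; rewrite (dot_basis _ _ _ uP).
  by do 2!apply: eq_bigr => ? _; rewrite mulrC.
rewrite mulr_sumr; apply: eq_bigr => i _.
rewrite Rintegral_sum; [|exact: measurable_unit_sphere|by move=> j; exact: int_ij].
rewrite (bigD1 i)//= big1 ?addr0 => [|j ji].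
  rewrite RintegralZl; [|exact: measurable_unit_sphere|exact: coord_mul_integrable].
  by rewrite moment_diag mulrC.
rewrite RintegralZl; [|exact: measurable_unit_sphere|exact: coord_mul_integrable].
by rewrite moment_offdiag ?mulr0// eq_sym.
Qed.

End orthonormal.

(** A single [c] serves all [psi], so [Mfun] is a nondecreasing function of the trace. *)
Lemma Mfun_trace phi P : orthonormal_basis phi P ->
  exists2 c : R, 0 <= c & forall psi,
    Mfun (unit_ball phi) (unit_ball psi) =
    Num.sqrt (c * \sum_i psi (row i P) (row i P)).
Proof.
move=> oP; have [[mu inv_mu]|noinv] :=
    pselect (exists mu, invariant_probability (unit_ball phi) mu).
  exists n%:R^-1; first by rewrite invr_ge0 ler0n.
  move=> psi; rewrite /Mfun boundary_unit_ball.
  have inv_E : invariant_probability (unit_ball phi) (inv_measure (unit_ball phi)).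
    exact: (xgetPex _ (ex_intro _ mu inv_mu)).
  rewrite -(Rintegral_dot oP inv_E); congr Num.sqrt.
  by apply: eq_Rintegral => x _; rewrite sqr_body_norm.
(* Here [inv_measure] is its default value, the Dirac mass at the origin; the origin is off the
   sphere, so the integral vanishes. *)
exists 0 => // psi; rewrite mul0r /Mfun boundary_unit_ball; congr Num.sqrt.
rewrite /inv_measure xgetPN => [|mu inv_mu]; last by apply: noinv; exists mu.
under eq_Rintegral do rewrite sqr_body_norm.
rewrite /Rintegral integral_dirac.
- by rewrite diracE memNset ?mul0e//= dot0l => /esym/eqP; rewrite oner_eq0.
- exact: (measurable_unit_sphere phi).
- apply/measurable_EFinP/measurable_funTS.
  exact: (continuous_borel_fun (@dot_continuous _ _ psi)).
Qed.

End moments.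

(** * Existence of an inscribed ellipsoid of minimal trace, by compactness *)

Section minimizer.
Context {R : realType} {n : nat}.
Implicit Types (phi psi : scalar_product R n) (x y : 'rV[R]_n) (P : 'M[R]_n).

(** When the rows of [P] are orthonormal for another scalar product, this is the trace of [phi]
    relative to it. *)
Definition form_trace P phi : R := \sum_i phi (row i P) (row i P).

(** Positivity on the sum and the difference of the two rows bounds the entry by the mean of two
    diagonal entries. A bound on the trace thus bounds the whole Gram matrix. *)
Lemma dot_row_le_trace P phi i j :
  `|phi (row i P) (row j P)| <= form_trace P phi.
Proof.
have le_tr k : phi (row k P) (row k P) <= form_trace P phi.
  by rewrite /form_trace (bigD1 k)//= lerDl sumr_ge0// => l _; exact: dot_ge0.
have := dot_ge0 phi (row i P + row j P).
have := dot_ge0 phi (row i P + (-1) *: row j P).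
rewrite !dotDl !dotDr !dotZl !dotZr (dotC phi (row j P)).
by move: (le_tr i) (le_tr j) => ? ? ? ?; rewrite ler_norml; apply/andP; split; lra.
Qed.

Section gram.
Variable P : 'M[R]_n.
Hypothesis uP : P \in unitmx.
Implicit Types v : 'rV[R]_(n * n).

(** The Gram matrix of the rows of [P], flattened to a row vector so that compactness of boxes of
    row vectors applies. *)
Definition gram phi : 'rV[R]_(n * n) :=
  mxvec (\matrix_(i, j) phi (row i P) (row j P)).

Definition gram_form v x : R :=
  \sum_i \sum_j (x *m invmx P) 0 i * (x *m invmx P) 0 j * v 0 (mxvec_index i j).

Definition gram_trace v : R := \sum_i v 0 (mxvec_index i i).

Lemma gram_formE phi x : gram_form (gram phi) x = phi x x.
Proof.
rewrite (dot_basis phi x x uP); do 2!apply: eq_bigr => ? _.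
by congr (_ * _); rewrite mxvecE mxE.
Qed.

Lemma gram_traceE phi : gram_trace (gram phi) = form_trace P phi.
Proof. by apply: eq_bigr => i _; rewrite mxvecE mxE. Qed.

Lemma gram_form_continuous x : continuous (gram_form^~ x).
Proof.
apply: sum_continuous => i; apply: sum_continuous => j.
apply: mul_continuous; first exact: cst_continuous.
exact: coord_continuous.
Qed.

Lemma gram_trace_continuous : continuous gram_trace.
Proof. by apply: sum_continuous => ?; exact: coord_continuous. Qed.

Lemma gram_formZ v a x : gram_form v (a *: x) = a ^+ 2 * gram_form v x.
Proof.
rewrite /gram_form mulr_sumr; apply: eq_bigr => i _; rewrite mulr_sumr.
by apply: eq_bigr => j _; rewrite -scalemxAl !mxE; ring.
Qed.

(** The matrix [S] of the form in the standard basis is chosen so that [P *m S *m P^T] is the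
    prescribed Gram matrix. *)
Lemma dot_of_gram v :
  (forall i j, v 0 (mxvec_index i j) = v 0 (mxvec_index j i)) ->
  (forall x, x != 0 -> 0 < gram_form v x) ->
  exists phi, gram phi = v.
Proof.
move=> symv posv; pose S : 'M[R]_n := invmx P *m vec_mx v *m (invmx P)^T.
have symB : (vec_mx v)^T = vec_mx v by apply/matrixP => i j; rewrite !mxE.
have formE x : (x *m S *m x^T) 0 0 = gram_form v x.
  rewrite /S !mulmxA -(mulmxA _ (invmx P)^T) -trmx_mul mxE /gram_form exchange_big.
  apply: eq_bigr => j _; rewrite [(_ *m vec_mx v) _ _]mxE mulr_suml.
  by apply: eq_bigr => i _; rewrite [X in _ * X]mxE [vec_mx _ _ _]mxE; ring.
have [|x x0|phi phiE] := @dot_of_matrix _ _ S.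
- by rewrite /S !trmx_mul trmxK symB mulmxA.
- by rewrite formE; exact: posv.
exists phi; rewrite -[RHS]vec_mxK /gram; congr mxvec.
transitivity (P *m S *m P^T).
  apply/matrixP => i j; rewrite mxE phiE -row_mul !mxE.
  by apply: eq_bigr => k _; rewrite !mxE.
rewrite /S !mulmxA mulmxV// mul1mx -mulmxA -trmx_mul mulmxV// trmx1 mulmx1 //.
Qed.

Variable K : set 'rV[R]_n.
Hypotheses (closedK : closed K) (boundedK : bounded_set K).

(* For a closed K, [unit_ball phi `<=` K] amounts to [1 <= phi x x] for all x outside
   K, a closed condition on phi; since K is bounded, it also forces phi to be positive
   definite. *)
Definition inscribed_gram (c : R) : set 'rV[R]_(n * n) :=
  [set v : 'rV[R]_(n * n) | forall k, v 0 k \in `[- c, c]] `&`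
  ([set v : 'rV[R]_(n * n) |
      forall i j, v 0 (mxvec_index i j) = v 0 (mxvec_index j i)] `&`
   [set v | forall x, ~ K x -> 1 <= gram_form v x]).

Lemma compact_inscribed_gram c : compact (inscribed_gram c).
Proof.
apply: compact_closedI.
  by apply: (@rV_compact _ _ (fun=> `[- c, c]%classic)) => _; exact: segment_compact.
apply: closedI.
  rewrite [X in closed X](_ : _ = \bigcap_i \bigcap_j
      [set v : 'rV[R]_(n * n) | v 0 (mxvec_index i j) = v 0 (mxvec_index j i)]); last first.
    by apply/seteqP; split => [v vC i _ j _|v vC i j]; [exact: vC|exact: (vC i I j I)].
  apply: closed_bigI => i _; apply: closed_bigI => j _.
  have -> : [set v : 'rV[R]_(n * n) | v 0 (mxvec_index i j) = v 0 (mxvec_index j i)]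
      = (fun v : 'rV[R]_(n * n) => v 0 (mxvec_index i j) - v 0 (mxvec_index j i)) @^-1` [set 0].
    by apply/seteqP; split => v /= => [->|/eqP]; rewrite ?subrr// subr_eq0 => /eqP.
  apply: closed_comp; last exact: closed_eq.
  move=> v _; apply: (@continuousB _ _ _ (fun v : 'rV[R]_(n * n) => v 0 (mxvec_index i j))
    (fun v : 'rV[R]_(n * n) => v 0 (mxvec_index j i))); exact: coord_continuous.
rewrite [X in closed X](_ : _ = \bigcap_(x in ~` K) [set v | 1 <= gram_form v x]); last first.
  by apply/seteqP; split.
apply: closed_bigI => x _.
apply: (@closed_comp _ _ (gram_form^~ x) [set r | 1 <= r]); last exact: closed_ge.
by move=> v _; exact: gram_form_continuous.
Qed.

Lemma gram_inscribed phi c : unit_ball phi `<=` K -> form_trace P phi <= c ->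
  inscribed_gram c (gram phi).
Proof.
move=> phiK trc; split; [|split].
- move=> k; case/mxvec_indexP: k => i j; rewrite mxvecE mxE in_itv /= -ler_norml.
  exact: le_trans (dot_row_le_trace _ _ _ _) trc.
- by move=> i j; rewrite !mxvecE !mxE dotC.
- move=> x Kx; rewrite gram_formE leNgt; apply/negP => /ltW x1.
  by apply: Kx; exact: phiK.
Qed.

Lemma inscribed_gram_dot c v : inscribed_gram c v ->
  exists2 phi, gram phi = v & unit_ball phi `<=` K.
Proof.
move=> [_ [symv vK]]; have [x x0|phi phiv] := dot_of_gram symv.
  have [M [_ /(_ (M + 1))]] := boundedK.
  rewrite ltrDl ltr01 => /(_ isT) KM.
  have nx : 0 < `|x| by rewrite normr_gt0.
  (* The vector [a *: x] has norm [|M| + 2], beyond the bound [M + 1] valid on [K]. The form is at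
     least 1 there, so by homogeneity it is positive at [x]. *)
  pose a := (`|M| + 2) / `|x|.
  have a0 : 0 < a by rewrite divr_gt0// ltr_wpDl.
  have : 1 <= gram_form v (a *: x).
    apply: vK => /KM; apply/negP; rewrite -ltNge normrZ gtr0_norm// divfK ?gt_eqF//.
    by have := ler_norm M; lra.
  rewrite gram_formZ => /(lt_le_trans ltr01); rewrite pmulr_rgt0// exprn_gt0//.
exists phi => // x; rewrite /unit_ball /= => x1; apply: contrapT => Kx.
(* The complement of [K] is open, so some [t *: x] with [t < 1] is still outside [K], where the form
   is at least 1; yet its value there is at most [t ^+ 2 < 1]. *)
have [t /andP[t0 t1]] := nbhs_scale_lt1 (open_nbhs_nbhs (conj (closed_openC closedK) Kx)).
move=> /vK; rewrite gram_formZ -phiv gram_formE leNgt => /negP; apply.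
apply: (@le_lt_trans _ _ (t ^+ 2)).
  by rewrite ler_piMr// sqr_ge0.
by rewrite exprn_ilt1// ltW.
Qed.

Lemma exists_minimal_trace psi0 : unit_ball psi0 `<=` K ->
  exists2 psi, unit_ball psi `<=` K &
    forall phi, unit_ball phi `<=` K -> form_trace P psi <= form_trace P phi.
Proof.
move=> psi0K; pose c := form_trace P psi0.
have [||v vC vmin] :=
    @compact_EVT_min _ _ gram_trace (inscribed_gram c) _ (@compact_inscribed_gram c).
- by exists (gram psi0); exact: gram_inscribed.
- exact/continuous_subspaceT/gram_trace_continuous.
have [psi psiv psiK] := inscribed_gram_dot (set_mem vC).
(* A competitor of trace above [c] is outside the compact set, but [psi0], which is in it, already
   does better. *)
exists psi => // phi phiK; have [trc|/ltW trc] := leP (form_trace P phi) c.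
  rewrite -!gram_traceE psiv; apply: vmin; apply/mem_set; exact: gram_inscribed.
apply: le_trans trc; rewrite /c -!gram_traceE psiv; apply: vmin; apply/mem_set.
exact: gram_inscribed.
Qed.

End gram.
End minimizer.

(** * Bases with a prescribed vector, geometry of closed bodies, and the comparison of two bodies *)

Section bodies.
Context {R : realType} {n : nat}.
Implicit Types (phi psi : scalar_product R n) (x y : 'rV[R]_n) (P : 'M[R]_n).

(** Take the form whose Gram matrix is the identity: it is the sum of the squared coordinates. *)
Lemma exists_orthonormal_dot P : P \in unitmx ->
  exists phi, orthonormal_basis phi P.
Proof.
move=> uP; pose v : 'rV[R]_(n * n) := mxvec 1%:M.
have vE i j : v 0 (mxvec_index i j) = (i == j)%:R by rewrite mxvecE mxE.
have formE x : gram_form P v x = \sum_i (x *m invmx P) 0 i ^+ 2.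
  apply: eq_bigr => i _; rewrite (bigD1 i)//= big1 ?addr0 => [|j ji].
    by rewrite vE eqxx mulr1 expr2.
  by rewrite vE eq_sym (negbTE ji) mulr0.
have [i j|x x0|phi phiv] := dot_of_gram uP (v := v).
- by rewrite !vE eq_sym.
- rewrite formE lt_neqAle sumr_ge0 ?andbT => [|i _]; last exact: sqr_ge0.
  apply: contra x0; rewrite eq_sym psumr_eq0 => [/allP s0|i _]; last exact: sqr_ge0.
  rewrite -(mulmxKV uP x); suff -> : x *m invmx P = 0 by rewrite mul0mx.
  apply/rowP => i; rewrite [RHS]mxE; apply/eqP.
  by rewrite -sqrf_eq0; apply: s0; rewrite mem_index_enum.
exists phi; split=> // i j.
by rewrite -vE -phiv mxvecE mxE.
Qed.

Section replace_row.
Variables (i : 'I_n) (x : 'rV[R]_n) (e : R).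

Definition scaled_basis : 'M[R]_n :=
  \matrix_j (if j == i then x else e *: delta_mx 0 j).

Lemma row_scaled_basis j :
  row j scaled_basis = if j == i then x else e *: delta_mx 0 j.
Proof. exact: rowK. Qed.

Lemma mulmx_scaled_basis (v : 'rV[R]_n) :
  v *m scaled_basis = v 0 i *: x + e *: \row_j (if j == i then 0 else v 0 j).
Proof.
rewrite mulmx_sum_row (bigD1 i)//= row_scaled_basis eqxx; congr (_ + _).
apply/rowP => k; rewrite summxE !mxE.
have [->|ki] := eqVneq k i.
  rewrite mulr0 big1// => j ji; rewrite row_scaled_basis (negbTE ji) !mxE.
  by rewrite eq_sym (negbTE ji) !mulr0.
rewrite (bigD1 k)//= row_scaled_basis (negbTE ki) !mxE !eqxx mulr1 mulrC.
rewrite big1 ?addr0// => j /andP[ji jk]; rewrite row_scaled_basis (negbTE ji) !mxE.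
by rewrite [k == j]eq_sym (negbTE jk) !mulr0.
Qed.

Lemma scaled_basis_unit : x 0 i != 0 -> e != 0 -> scaled_basis \in unitmx.
Proof.
move=> xi e0; rewrite -row_free_unit -kermx_eq0; apply/rowV0P => v /sub_kermxP.
rewrite mulmx_scaled_basis => /rowP v0.
have vi : v 0 i = 0.
  move: (v0 i); rewrite !mxE eqxx mulr0 addr0 => /eqP.
  by rewrite mulf_eq0 (negbTE xi) orbF => /eqP.
apply/rowP => j; move: (v0 j); rewrite !mxE vi mul0r add0r.
by case: eqVneq => [-> _//|_ /eqP]; rewrite mulf_eq0 (negbTE e0) => /eqP.
Qed.

End replace_row.

Section closed_body.
Variable K : set 'rV[R]_n.
Hypothesis bodyK : closed_body K.

Lemma body_closed : closed K.
Proof. by case: bodyK => cK _ _ _; apply: compact_closed cK; exact: norm_hausdorff. Qed.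

Lemma body_bounded : bounded_set K.
Proof. by case: bodyK => cK _ _ _; exact: compact_bounded. Qed.

Lemma body_opp x : K x -> K (- x).
Proof. by move=> Kx; case: bodyK => _ _ <- _; exists x. Qed.

Lemma body_convex (t : R) x y : 0 <= t <= 1 -> K x -> K y ->
  K (t *: x + (1 - t) *: y).
Proof.
move=> t01 Kx Ky; have [_ cvxK _ _] := bodyK.
pose l : {i01 R} := Itv01 (andP t01).1 (andP t01).2.
exact: set_mem (cvxK x y l (mem_set Kx) (mem_set Ky)).
Qed.

(** If [K] contains a ball around [z], it contains the opposite ball by symmetry; [x] is the
    midpoint of [z + x] and [- (z - x)]. *)
Lemma body_ball : exists2 r : R, 0 < r & forall x, `|x| < r -> K x.
Proof.
have [_ _ _ [z /nbhs_ballP[r /= r0 zrK]]] := bodyK.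
exists r => // x xr.
have Kzx y : `|y| < r -> K (z + y).
  by move=> yr; apply: zrK; rewrite -ball_normE /= opprD addNKr normrN.
have Kzx' : K (- (z - x)) by apply: body_opp; apply: Kzx; rewrite normrN.
have -> : x = 2^-1 *: (z + x) + (1 - 2^-1) *: - (z - x).
  by apply/rowP => i; rewrite !mxE; lra.
by apply: body_convex Kzx' => //; [apply/andP; split; lra|exact: Kzx].
Qed.

Lemma body_scale (a : R) x : `|a| <= 1 -> K x -> K (a *: x).
Proof.
move=> a1 Kx; have -> : a *: x = ((1 + a) / 2) *: x + (1 - (1 + a) / 2) *: - x.
  by apply/rowP => i; rewrite !mxE; lra.
apply: body_convex (body_opp Kx) => //.
by move: a1; rewrite ler_norml => /andP[? ?]; apply/andP; split; lra.
Qed.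

(** The ellipsoid has [t *: x] as one semi-axis, and the others are short enough to fit in the room
    left by [t < 1]. *)
Lemma thin_ellipsoid_sub i x (t : R) : x 0 i != 0 -> 0 < t < 1 -> K x ->
  exists2 phi, unit_ball phi `<=` K & phi (t *: x) (t *: x) = 1.
Proof.
move=> xi /andP[t0 t1] Kx; have [r r0 rK] := body_ball.
(* The factor [1 - t] becomes the convex weight of a vector of norm at most [r / 2], which is in
   [K]. *)
pose e := (1 - t) * (r / 2).
have e0 : 0 < e by rewrite mulr_gt0 ?subr_gt0 ?divr_gt0.
have uP : scaled_basis i (t *: x) e \in unitmx.
  apply: scaled_basis_unit; last by rewrite gt_eqF.
  by rewrite mxE mulf_neq0 // gt_eqF.
have [phi oP] := exists_orthonormal_dot uP.
exists phi; last by have := oP.2 i i; rewrite !row_scaled_basis !eqxx.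
(* Since coordinates are at most 1 in absolute value, [y] is a combination, with weights [t] and
   [1 - t], of a multiple of [x] in [K] and a vector of the small ball. *)
move=> y y1; have yc j := orthonormal_coord_le1 oP j y1.
rewrite -(mulmxKV uP y) mulmx_scaled_basis scalerA mulrC -scalerA.
rewrite -(scalerA (1 - t)); apply: body_convex; first by rewrite !ltW.
  exact: body_scale.
apply: rK; rewrite normrZ gtr0_norm ?divr_gt0//.
apply: (@le_lt_trans _ _ (r / 2)); last lra.
rewrite -[leRHS]mulr1 ler_wpM2l ?divr_ge0 ?(ltW r0)//.
rewrite [leLHS]mx_normrE; apply/bigmax_leP; split => // -[k j] _ /=; rewrite mxE.
by case: ifP => _; rewrite ?normr0 ?yc.
Qed.

(** [Mfun] being nondecreasing in the trace, a trace minimizer attains the infimum [Jfun]. *)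
Lemma minimal_trace_is_u phi P psi : orthonormal_basis phi P ->
  unit_ball psi `<=` K ->
  (forall psi', unit_ball psi' `<=` K -> form_trace P psi <= form_trace P psi') ->
  is_u K (unit_ball phi) (unit_ball psi).
Proof.
move=> oP psiK psi_min; split => //; first by exists psi.
have [c c0 ME] := Mfun_trace oP.
have mem : [set Mfun (unit_ball phi) F | F in [set F | ellipsoid F /\ F `<=` K]]
    (Mfun (unit_ball phi) (unit_ball psi)).
  by exists (unit_ball psi) => //; split => //; exists psi.
have lb : lbound [set Mfun (unit_ball phi) F | F in [set F | ellipsoid F /\ F `<=` K]]
    (Mfun (unit_ball phi) (unit_ball psi)).
  move=> _ [_ [[psi' ->] psi'K] <-]; rewrite !ME ler_wsqrtr//.
  by rewrite ler_wpM2l//; exact: psi_min.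
apply/eqP; rewrite eq_le /Jfun lb_le_inf//=; last by eexists; exact: mem.
by apply: ge_inf => //; eexists; exact: lb.
Qed.

End closed_body.

Lemma body_sub (K T : set 'rV[R]_n) : closed_body K -> closed_body T ->
  (forall E, ellipsoid E -> forall F, is_u K E F -> is_u T E F) -> K `<=` T.
Proof.
move=> bodyK bodyT uKT x Kx; apply: contrapT => Tx.
have [x0|] := eqVneq x 0.
  by have [r r0 rT] := body_ball bodyT; apply: Tx; apply: rT; rewrite x0 normr0.
move=> /rV0Pn[i xi].
have [s /andP[s0 s1]] :=
  nbhs_scale_lt1 (open_nbhs_nbhs (conj (closed_openC (body_closed bodyT)) Tx)).
(* It remains to derive [T (s *: x)]. With [t ^+ 2 = s], an ellipsoid having [t *: x] on its
   boundary gives [s *: x] the squared norm [s < 1]. *)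
apply; pose t := Num.sqrt s.
have t2 : t ^+ 2 = s by rewrite sqr_sqrtr// ltW.
have t0 : 0 < t by rewrite sqrtr_gt0.
have t1 : t < 1 by rewrite -sqrtr1 ltr_sqrt.
have [psi0 psi0K psi0x] := thin_ellipsoid_sub bodyK xi (introT andP (conj t0 t1)) Kx.
pose A := \sum_(j | j != i) psi0 (delta_mx 0 j) (delta_mx 0 j).
have A0 : 0 <= A by apply: sumr_ge0 => j _; exact: dot_ge0.
(* With this [e], the trace of [psi0] in the scaled basis, [s + e ^+ 2 * A], is below 1. *)
pose e := (1 - s) / (A + 1).
have A1 : 0 < A + 1 by rewrite ltr_wpDl.
have e0 : 0 < e by rewrite divr_gt0 ?subr_gt0.
have e1 : e <= 1 by rewrite ler_pdivrMr//; lra.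
have eA : e * A < 1 - s.
  rewrite /e mulrAC ltr_pdivrMr// ltr_pM2l ?subr_gt0//; lra.
have uP : scaled_basis i (s *: x) e \in unitmx.
  apply: scaled_basis_unit; last by rewrite gt_eqF.
  by rewrite mxE mulf_neq0 // gt_eqF.
have [phi oP] := exists_orthonormal_dot uP.
have [psi psiK psi_min] :=
  exists_minimal_trace uP (body_closed bodyK) (body_bounded bodyK) psi0K.
have [_ psiT _] := uKT _ (ex_intro _ phi erefl) _ (minimal_trace_is_u oP psiK psi_min).
apply: psiT; rewrite /unit_ball /=.
(* The value of [psi] at [s *: x] is one of the nonnegative terms of its trace, which is at most
   that of [psi0]. *)
apply: (@le_trans _ _ (form_trace (scaled_basis i (s *: x) e) psi)).
  rewrite /form_trace (bigD1 i)//= row_scaled_basis eqxx lerDl.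
  by apply: sumr_ge0 => j _; exact: dot_ge0.
apply: le_trans (psi_min _ psi0K) _.
rewrite /form_trace (bigD1 i)//= row_scaled_basis eqxx.
rewrite (eq_bigr (fun j => e ^+ 2 * psi0 (delta_mx 0 j) (delta_mx 0 j))); last first.
  by move=> j ji; rewrite row_scaled_basis (negbTE ji) dotZZ.
rewrite -mulr_sumr -/A -t2 expr2 -scalerA dotZZ psi0x mulr1 t2.
have : e ^+ 2 * A <= e * A by rewrite ler_wpM2r// expr2 ler_piMl// ltW.
lra.
Qed.

End bodies.

Theorem corollary4p3 (R : realType) (n : nat) (K T : set 'rV[R]_n)
    (bodyK : closed_body K) (bodyT : closed_body T)
    (uKT : forall E : set 'rV[R]_n, ellipsoid E ->
       forall F : set 'rV[R]_n, is_u K E F <-> is_u T E F) :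
  K = T.
Proof.
by apply/seteqP; split; apply: body_sub => // E elE F /uKT; apply.
Qed.
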